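(* For every $N\in\mathbb{N}$, the distribution of the random integer $I_N=\prod_{j=1}^N p_j^{X_{p_j}}$ is $P_N$; that is, $$P_N(\{n\})=P(I_N=n),\qquad n\in\Omega_N.$$
   Context: $\{p_j\}_{j=1}^\infty$ denotes the primes in increasing order. $\Omega_N=\{n\in\mathbb{N}: p_j\nmid n \text{ for all } j>N\}$ is the set of positive integers with no prime divisor larger than $p_N$. $C_N=\sum_{n\in\Omega_N}\frac1n=\prod_{j=1}^N(1-\frac1{p_j})^{-1}<\infty$, and $P_N$ is the probability measure on $\Omega_N$ given by $P_N(\{n\})=\frac1{C_N}\frac1n$, $n\in\Omega_N$. The random variables $\{X_{p_j}\}_{j=1}^\infty$ are independent, defined on some probability space with probability $P$, and $X_{p_j}$ has the Geom$(1-\frac1{p_j})$ distribution: $P(X_{p_j}=m)=(\frac1{p_j})^m(1-\frac1{p_j})$, $m=0,1,2,\ldots$. *)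

(* Defs.v *)
From HB Require Import structures.
From mathcomp Require Import all_boot all_order all_algebra finmap.
From mathcomp Require Import all_classical all_reals all_analysis.

Set Implicit Arguments.
Unset Strict Implicit.
Unset Printing Implicit Defensive.

Import Order.TTheory GRing.Theory Num.Theory.
Import numFieldNormedType.Exports.

Local Open Scope classical_set_scope.
Local Open Scope ring_scope.

Lemma prime_above_ex (m : nat) : exists q, (m < q)%N && prime q.
Proof. by have [q mq pq] := prime_above m; exists q; rewrite mq. Qed.

(* The primes are numbered from 1, so p_1 = 2; the value 1 at index 0 is only
   there to start the recursion. *)
Fixpoint nth_prime (j : nat) : nat :=
  if j is i.+1 then ex_minn (prime_above_ex (nth_prime i)) else 1%N.

Lemma nth_prime_prime (j : nat) : (0 < j)%N -> prime (nth_prime j).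
Proof. by case: j => // j _ /=; case: ex_minnP => q /andP[]. Qed.

Lemma nth_prime_ltS (j : nat) : (nth_prime j < nth_prime j.+1)%N.
Proof. by rewrite /=; case: ex_minnP => q /andP[]. Qed.

Lemma nth_prime_gt (j : nat) : (j < nth_prime j)%N.
Proof. by elim: j => // j IH; exact: leq_ltn_trans IH (nth_prime_ltS j). Qed.

Lemma nth_prime_surj (q : nat) :
  prime q -> exists2 j, (0 < j)%N & nth_prime j = q.
Proof.
move=> pq; have ex : exists j, (q <= nth_prime j)%N.
  by exists q; exact/ltnW/nth_prime_gt.
case: (ex_minnP ex) => -[|j] qj min.
  by move: (prime_gt1 pq); rewrite ltnNge qj.
exists j.+1 => //; apply/eqP; rewrite eqn_leq qj andbT /=.
case: ex_minnP => r _; apply; rewrite pq andbT ltnNge.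
by apply/negP => /min; rewrite ltnn.
Qed.

Definition Omega (N : nat) : set nat :=
  [set n | (0 < n)%N /\
           forall j : nat, (N < j)%N -> ~~ (nth_prime j %| n)%N].

Lemma Omega0 : Omega 0 = [set 1%N].
Proof.
apply/seteqP; split=> [n [n0 nd]|_ ->] /=.
  have [//|n_gt1|->//] := ltngtP n 1%N; first by rewrite ltnNge n0.
  have [j j0 jE] := nth_prime_surj (pdiv_prime n_gt1).
  by have := nd j j0; rewrite jE pdiv_dvd.
split=> // j /nth_prime_prime/prime_gt1.
by rewrite dvdn1; case: eqP => // ->.
Qed.

Section prime_power_product.
Context d (T : measurableType d).

Let measurable_pow (p : nat) (f : T -> nat) : measurable_fun setT f ->
  measurable_fun setT (fun w => p ^ f w)%N.
Proof. by move=> mf; apply: (measurableT_comp (f := expn p)). Qed.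

Let measurable_muln (f g : T -> nat) : measurable_fun setT f ->
  measurable_fun setT g -> measurable_fun setT (fun w => f w * g w)%N.
Proof.
move=> mf mg _ B _; rewrite setTI.
have -> : (fun w => f w * g w)%N @^-1` B =
    \bigcup_a ((f @^-1` [set a]) `&` (g @^-1` [set b | B (a * b)%N])).
  apply/seteqP; split=> [w /= Bw|w [a _ [/= <-]]//].
  by exists (f w).
apply: bigcupT_measurable => a; apply: measurableI.
  by rewrite -[X in measurable X]setTI; exact: mf.
by rewrite -[X in measurable X]setTI; exact: mg.
Qed.

Definition prime_power_product (N : nat) (X : nat -> {mfun T >-> nat}) (w : T)
    : nat := (\prod_(1 <= j < N.+1) nth_prime j ^ X j w)%N.

Lemma measurable_prime_power_product (N : nat) (X : nat -> {mfun T >-> nat}) :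
  measurable_fun setT (prime_power_product N X).
Proof.
elim: N => [|N IH].
  rewrite (_ : prime_power_product _ _ = cst 1%N)//.
  by apply/funext => w; rewrite /prime_power_product big_nil.
rewrite (_ : prime_power_product _ _ =
    (fun w => prime_power_product N X w * nth_prime N.+1 ^ X N.+1 w)%N).
  by apply: measurable_muln => //; apply: measurable_pow; exact: measurable_funPT.
by apply/funext => w; rewrite /prime_power_product big_nat_recr.
Qed.

HB.instance Definition _ (N : nat) (X : nat -> {mfun T >-> nat}) :=
  isMeasurableFun.Build _ _ _ _ (prime_power_product N X)
    (measurable_prime_power_product N X).

End prime_power_product.

Local Open Scope ereal_scope.

Definition mutually_independent (d d' : measure_display)
    (T : measurableType d) (T' : measurableType d') (R : realType)
    (P : probability T R) (I : choiceType) (J : set I)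
    (X : I -> {RV P >-> T'}) : Prop :=
  forall (F : {fset I}) (A : I -> set T'),
    [set` F] `<=` J -> (forall i, measurable (A i)) ->
    P (\bigcap_(i in [set` F]) (X i @^-1` A i)) =
    \prod_(i <- F) P (X i @^-1` A i).

Section harmonic_prob.
Context (R : realType).

Definition harmonic_mass (N : nat) : \bar R :=
  \esum_(n in Omega N) (n%:R^-1)%:E.

Let esumZ (S : set nat) (c : R) (a : nat -> R) : (0 <= c)%R ->
  (forall n, 0 <= a n)%R ->
  \esum_(n in S) (c * a n)%:E = c%:E * \esum_(n in S) (a n)%:E.
Proof.
move=> c0 a0; rewrite esum_mkcond [in RHS]esum_mkcond.
rewrite -!nneseries_esumT; last 2 first.
- by move=> n; case: ifP; rewrite // lee_fin.
- by move=> n; case: ifP; rewrite // lee_fin mulr_ge0.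
rewrite -nneseriesZl//; last by move=> n _; case: ifP; rewrite // lee_fin.
by apply: eq_eseriesr => n _; case: ifP; rewrite ?mule0 ?EFinM.
Qed.

Let geo_fin (q : nat) : (1 < q)%N ->
  \esum_(k in [set: nat]) (((q%:R : R)^-1) ^+ k)%:E < +oo.
Proof.
move=> q1; rewrite -nneseries_esumT; last first.
  by move=> k; rewrite lee_fin exprn_ge0// invr_ge0.
have q1' : (`|(q%:R : R)^-1| < 1)%R.
  by rewrite ger0_norm ?invr_ge0// invf_lt1 ?ltr0n ?ltr1n//; exact: ltnW.
suff -> : \sum_(k <oo) (((q%:R : R)^-1) ^+ k)%:E = (1 / (1 - q%:R^-1) : R)%:E.
  by rewrite ltry.
apply: cvg_lim => //; under eq_fun do rewrite sumEFin.
apply: cvg_EFin; first exact: nearW.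
apply: cvg_trans (cvg_geometric_series q1').
rewrite (_ : _ \o _ = series (geometric 1%R (q%:R^-1)%R))//.
apply/funext => n; rewrite /series /=.
by apply: eq_bigr => k _; rewrite mul1r.
Qed.

Lemma harmonic_mass_lty (N : nat) : harmonic_mass N < +oo.
Proof.
elim: N => [|N IH]; first by rewrite /harmonic_mass Omega0 esum_set1// ltry.
set q := nth_prime N.+1.
have pq : prime q by exact: nth_prime_prime.
have fst_Omega n : Omega N.+1 n -> Omega N (n`_q^')%N.
  case=> n0 nd; split; first exact: part_gt0.
  move=> j; rewrite leq_eqVlt => /orP[/eqP <-|/nd]; last first.
    by apply: contra => /dvdn_trans; apply; exact: dvdn_part.
  apply/negP => /(pnatP _ (part_gt0 _ n) (part_pnat _ n)) - /(_ pq).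
  by rewrite !inE eqxx.
have key : harmonic_mass N.+1 <=
    \esum_(x in Omega N `*`` (fun=> [set: nat]))
      ((x.1%:R^-1 * (q%:R^-1) ^+ x.2 : R))%:E.
  set e := fun n : nat => ((n`_q^')%N, logn q n).
  have eE n : (0 < n)%N -> ((e n).1 * q ^ (e n).2 = n)%N.
    by move=> n0; rewrite /e /= -p_part mulnC partnC.
  have einj : set_inj (Omega N.+1) e.
    move=> m n /set_mem[m0 _] /set_mem[n0 _] emn.
    by rewrite -(eE m)// -(eE n)// emn.
  rewrite /harmonic_mass.
  pose w (x : nat * nat) := ((x.1%:R^-1 * (q%:R^-1) ^+ x.2 : R))%:E.
  rewrite (eq_esum (b := fun n => w (e n))).
    rewrite -(esum_image (Omega N.+1) e w einj); apply: le_ereal_sup.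
    apply: image_subset => A [finA AS]; split=> // x /AS[n nO <-].
    by split => //=; exact: fst_Omega.
  move=> n [n0 _]; rewrite -{1}(eE n n0) /w /= natrM natrX invfM exprVn.
  by [].
apply: le_lt_trans key _.
rewrite -(@esum_esum _ _ _ (Omega N) (fun=> setT)
  (fun m k => ((m%:R^-1 * (q%:R^-1) ^+ k : R))%:E)); last first.
  by move=> m k _ _; rewrite lee_fin mulr_ge0// ?exprn_ge0 ?invr_ge0.
have gf := geo_fin (prime_gt1 pq).
have g0 : 0 <= \esum_(k in [set: nat]) (((q%:R : R)^-1) ^+ k)%:E.
  by apply: esum_ge0 => k _; rewrite lee_fin exprn_ge0// invr_ge0.
have gE : \esum_(k in [set: nat]) (((q%:R : R)^-1) ^+ k)%:E =
    (fine (\esum_(k in [set: nat]) (((q%:R : R)^-1) ^+ k)%:E))%:E.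
  by rewrite fineK// ge0_fin_numE.
set g := fine _ in gE.
have g_ge0 : (0 <= g)%R by rewrite -lee_fin -gE.
rewrite (eq_esum (b := fun n => (g * n%:R^-1)%:E)).
  by rewrite esumZ// lte_mul_pinfty// ?lee_fin//.
move=> m _; rewrite esumZ ?invr_ge0// ?gE -?EFinM ?[(g * _)%R]mulrC//.
Qed.

Lemma harmonic_mass_gt0 (N : nat) : 0 < harmonic_mass N.
Proof.
apply: (@lt_le_trans _ _ 1); first by rewrite lte01.
have O1 : [set 1%N] `<=` Omega N.
  rewrite -Omega0 => n [n0 nd]; split=> // j Nj; apply: nd.
  exact: leq_ltn_trans Nj.
rewrite -[leLHS](_ : \esum_(n in [set 1%N]) ((n%:R : R)^-1)%:E = 1).
  by apply: le_ereal_sup; apply: image_subset => A [finA AS]; split=> // n /AS/O1.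
by rewrite esum_set1// invr1.
Qed.

(* The probability on Omega N giving n the weight 1 / (C_N * n), where C_N is
   harmonic_mass N, extended by 0 to a measure on all of nat. *)
Definition harmonic_prob (N : nat) (A : set nat) : \bar R :=
  \esum_(n in A `&` Omega N) ((fine (harmonic_mass N))^-1 * n%:R^-1)%:E.

Section instances.
Variable N : nat.

Let weight_ge0 (n : nat) :
  0 <= ((fine (harmonic_mass N))^-1 * n%:R^-1)%:E.
Proof. by rewrite lee_fin mulr_ge0// invr_ge0// fine_ge0// ltW// harmonic_mass_gt0. Qed.

Let harmonic_prob0 : harmonic_prob N set0 = 0.
Proof. by rewrite /harmonic_prob set0I esum_set0. Qed.

Let harmonic_prob_ge0 (A : set nat) : 0 <= harmonic_prob N A.
Proof. exact: esum_ge0. Qed.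

Let harmonic_prob_sigma_additive : semi_sigma_additive (harmonic_prob N).
Proof.
move=> F mF tF mUF; rewrite /harmonic_prob setI_bigcupl; apply: cvg_toP.
  apply: ereal_nondecreasing_is_cvgn => a b ab.
  by apply: lee_sum_nneg_natr => // n _ _; exact: esum_ge0.
by rewrite nneseries_sum_bigcup//; exact: trivIset_setIr.
Qed.

HB.instance Definition _ := isMeasure.Build _ _ _ (harmonic_prob N)
  harmonic_prob0 harmonic_prob_ge0 harmonic_prob_sigma_additive.

Let harmonic_prob_setT : harmonic_prob N [set: nat] = 1.
Proof.
rewrite /harmonic_prob setTI esumZ; last 2 first.
- by rewrite invr_ge0 fine_ge0// ltW// harmonic_mass_gt0.
- by move=> n; rewrite invr_ge0.
have H0 := harmonic_mass_gt0 N; have Hoo := harmonic_mass_lty N.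
rewrite -/(harmonic_mass N) -[X in _ * X](fineK (x := harmonic_mass N)).
  by rewrite -EFinM mulVf// gt_eqF// fine_gt0// H0 Hoo.
by rewrite ge0_fin_numE// ltW.
Qed.

HB.instance Definition _ := @Measure_isProbability.Build _ _ R
  (harmonic_prob N) harmonic_prob_setT.

End instances.

Lemma harmonic_prob_set1 (N n : nat) : Omega N n ->
  harmonic_prob N [set n] = ((fine (harmonic_mass N))^-1 * n%:R^-1)%:E.
Proof.
move=> On; rewrite /harmonic_prob (_ : _ `&` _ = [set n]); last first.
  by apply/seteqP; split=> [m []//|m ->].
by rewrite esum_set1// lee_fin mulr_ge0// invr_ge0// fine_ge0// ltW// harmonic_mass_gt0.
Qed.

End harmonic_prob.

(* Main.v *)
Require Import Defs.
From mathcomp Require Import all_boot all_order all_algebra finmap.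
From mathcomp Require Import all_classical all_reals all_analysis.

Import Order.TTheory GRing.Theory Num.Theory.
Import numFieldNormedType.Exports.

Local Open Scope classical_set_scope.
Local Open Scope ring_scope.
Local Open Scope ereal_scope.

(** The theorem is unique factorization read probabilistically.  For [n] in
    [Omega N] the event [I_N = n] says that each [X j] with [1 <= j <= N] is
    the exponent of [p_j] in [n] ([prod_nth_prime_eq]).  Independence turns its
    probability into a product of geometric weights
    [(1 / p_j) ^ e_j * (1 - 1 / p_j)]; the first factors multiply to [1 / n],
    the second ones to the constant [\prod_j (1 - 1 / p_j)]
    ([prime_power_product_pmf]).  As [I_N] only takes values in [Omega N]
    ([prod_nth_prime_Omega]), its law and the harmonic law have proportional
    point masses.

    The Euler product for the normalizing constant is not evaluated: two
    probability measures on the naturals with proportional point masses are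
    equal, because the total masses force the ratio to be one
    ([probability_nat_proportional]).  That [C_N] is the inverse of
    [\prod_j (1 - 1 / p_j)] is then a consequence. *)

Lemma nth_prime_homo : {homo nth_prime : i j / (i < j)%N}.
Proof. exact: (homo_ltn ltn_trans nth_prime_ltS). Qed.

Lemma nth_prime_inj : injective nth_prime.
Proof.
by move=> i j ij; case: (ltngtP i j) => // /nth_prime_homo; rewrite ij ltnn.
Qed.

Lemma prod_nth_prime_gt0 (N : nat) (e : nat -> nat) :
  (0 < \prod_(1 <= j < N.+1) nth_prime j ^ e j)%N.
Proof.
apply: prodn_gt0 => j; rewrite expn_gt0.
by rewrite (leq_ltn_trans (leq0n j) (nth_prime_gt j)).
Qed.

Lemma logn_prod_nth_prime (N : nat) (e : nat -> nat) (j : nat) : (0 < j)%N ->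
  logn (nth_prime j) (\prod_(1 <= i < N.+1) nth_prime i ^ e i) =
  if (j <= N)%N then e j else 0%N.
Proof.
move=> j0; elim: N => [|N IH].
  by rewrite big_nil logn1 leqNgt j0.
have pN : prime (nth_prime N.+1) by exact: nth_prime_prime.
rewrite big_nat_recr// lognM ?prod_nth_prime_gt0 ?expn_gt0 ?prime_gt0//.
rewrite IH lognX logn_prime// (inj_eq nth_prime_inj).
case: (ltngtP j N.+1) => [jN|jN|->].
- by rewrite -ltnS jN muln0 addn0.
- by rewrite leqNgt (ltn_trans _ jN)// muln0.
- by rewrite ltnn muln1.
Qed.

Lemma prod_nth_prime_Omega (N : nat) (e : nat -> nat) :
  Omega N (\prod_(1 <= j < N.+1) nth_prime j ^ e j)%N.
Proof.
split=> [|j Nj]; first exact: prod_nth_prime_gt0.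
have j0 : (0 < j)%N by exact: leq_ltn_trans Nj.
apply/negP => pj; have := logn_prod_nth_prime N e j j0.
rewrite leqNgt Nj/= => /eqP; rewrite -leqn0 leqNgt logn_gt0 mem_primes.
by rewrite nth_prime_prime// prod_nth_prime_gt0 pj.
Qed.

(** Unique factorization for the integers whose prime divisors are among the
    first [N] primes: a positive integer is determined by its [p]-adic
    valuations, and the valuations at the primes beyond [p_N] vanish on both
    sides. *)
Lemma prod_nth_prime_eq (N n : nat) (e : nat -> nat) : Omega N n ->
  (\prod_(1 <= j < N.+1) nth_prime j ^ e j)%N = n <->
  forall j, (0 < j <= N)%N -> e j = logn (nth_prime j) n.
Proof.
case=> n0 nd; split=> [<- j /andP[j0 jN]|en].
  by rewrite logn_prod_nth_prime// jN.
apply/eqn_from_log => //; first exact: prod_nth_prime_gt0.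
move=> q /=; have [pq|npq] := boolP (prime q).
  have [j j0 <-] := nth_prime_surj pq.
  rewrite logn_prod_nth_prime//; case: leqP => [jN|Nj].
    by rewrite en// j0.
  by rewrite lognE (negbTE (nd j Nj)) !andbF.
by rewrite [LHS]lognE [RHS]lognE (negbTE npq).
Qed.

(** Every set of naturals is a countable union of points, so point masses
    determine a measure. *)
Lemma measure_nat_pmf (R : realType) (mu : {measure set nat -> \bar R})
    (A : set nat) :
  mu A = \sum_(n <oo | n \in A) mu [set n].
Proof.
rewrite -[in LHS](image_id A) -bigcup_imset1 measure_bigcup//.
by move=> i j _ _ [n [-> ->]].
Qed.

Lemma probability_nat_proportional (R : realType) (mu nu : probability nat R)
    (r : R) :
  (forall n, mu [set n] = r%:E * nu [set n]) -> forall A, mu A = nu A.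
Proof.
move=> mn; have mnA A : mu A = r%:E * nu A.
  rewrite !measure_nat_pmf -nneseriesZl//.
  by apply: eq_eseriesr => n _; exact: mn.
(* The ratio is read off on the whole space, where both sides are 1. *)
have /eqP := mnA [set: nat]; rewrite !probability_setT mule1 eqe => /eqP r1 A.
by rewrite mnA -r1 mul1e.
Qed.

Section pmf.
Context (R : realType) (d : measure_display) (T : measurableType d).
Context (P : probability T R) (X : nat -> {RV P >-> nat}).
Hypothesis X_indep : mutually_independent [set j : nat | (0 < j)%N] X.

Lemma joint_pmf (N : nat) (e : nat -> nat) :
  P [set w | forall j, (0 < j <= N)%N -> X j w = e j] =
  \prod_(1 <= j < N.+1) P [set w | X j w = e j].
Proof.
pose F : {fset nat} := [fset j | j in index_iota 1 N.+1]%fset.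
have FE j : (j \in F) = (0 < j <= N)%N by rewrite !inE /= mem_index_iota.
have FJ : [set` F] `<=` [set j : nat | (0 < j)%N].
  by move=> j /=; rewrite FE => /andP[].
have := X_indep F (fun j => [set e j]) FJ (fun=> I).
rewrite (perm_big (index_iota 1 N.+1)); last first.
  apply: uniq_perm; rewrite ?fset_uniq ?iota_uniq// => j.
  by rewrite FE mem_index_iota.
move=> <-; congr (P _); apply/seteqP; split=> w /= H j.
  by rewrite /= FE; exact: H.
by move=> jN; apply: H; rewrite /= FE.
Qed.

Hypothesis X_geom : forall j : nat, (0 < j)%N -> forall m : nat,
  P [set w | X j w = m] =
  (((nth_prime j)%:R^-1) ^+ m * (1 - (nth_prime j)%:R^-1))%:E.

Lemma prime_power_product_pmf (N n : nat) : Omega N n ->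
  P [set w | prime_power_product N X w = n] =
  (\prod_(1 <= j < N.+1) (1 - (nth_prime j)%:R^-1) / n%:R)%:E.
Proof.
move=> On; pose e j := logn (nth_prime j) n.
have -> : [set w | prime_power_product N X w = n] =
    [set w | forall j, (0 < j <= N)%N -> X j w = e j].
  by apply/seteqP; split=> w /(prod_nth_prime_eq N n (X ^~ w) On).
have nE : (\prod_(1 <= j < N.+1) nth_prime j ^ e j)%N = n.
  exact/(prod_nth_prime_eq N n e On).
rewrite joint_pmf -[in RHS]nE natr_prod -prodfV -big_split/= -prodEFin.
apply: eq_big_nat => j /andP[j0 _].
by rewrite X_geom// natrX exprVn mulrC.
Qed.

End pmf.

(* X j is the random variable attached to the prime nth_prime j, j >= 1. *)
Theorem proposition1 (R : realType) (d : measure_display)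
    (T : measurableType d) (P : probability T R) (X : nat -> {RV P >-> nat})
    (X_indep : mutually_independent [set j : nat | (0 < j)%N] X)
    (X_geom : forall j : nat, (0 < j)%N -> forall m : nat,
       P [set w | X j w = m] =
       (((nth_prime j)%:R^-1) ^+ m * (1 - (nth_prime j)%:R^-1))%:E)
    (N : nat) (N_gt0 : (0 < N)%N) :
  distribution P (prime_power_product N X) = harmonic_prob R N :> (set nat -> \bar R)
  /\ forall n : nat, Omega N n ->
       harmonic_prob R N [set n] = P [set w | prime_power_product N X w = n].
Proof.
pose C : R := fine (harmonic_mass R N).
have C_neq0 : C != 0%R.
  by rewrite gt_eqF// fine_gt0// harmonic_mass_gt0 harmonic_mass_lty.
pose K : R := (\prod_(1 <= j < N.+1) (1 - (nth_prime j)%:R^-1))%R.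
have same_law A : distribution P (prime_power_product N X) A =
    harmonic_prob R N A.
  (* The point masses are K / n and 1 / (C * n), so their ratio is K * C. *)
  apply: (probability_nat_proportional R _ _ (K * C)%R) => n.
  have [On|nOn] := pselect (Omega N n).
    transitivity (K / n%:R)%:E; first exact: prime_power_product_pmf.
    by rewrite /= harmonic_prob_set1// -EFinM -/C mulrA mulfK.
  transitivity (0 : \bar R).
    rewrite -(measure0 P); congr (P _).
    apply/seteqP; split=> // w /= In; apply: nOn; rewrite -In.
    exact: prod_nth_prime_Omega.
  rewrite /= /harmonic_prob (_ : _ `&` _ = set0) ?esum_set0 ?mule0//.
  by apply/seteqP; split=> // m [/= ->].
by split=> [|n _]; [exact/funext | rewrite -same_law].
Qed.
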